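(* Let $c > 0$ and $3/4 < \alpha \leq 1$. For each integer $N \geq 1$ let $\mathcal{S}_{\alpha}(N)$ denote the set of $x \in [0,1]$ such that $$\sup_{0<t<1} \Big| \sum_{n=1}^{N} e^{2\pi i (xn + tn^2)} \Big| \geq c N^{\alpha}.$$ Then for every $\epsilon > 0$ there is a constant $C > 0$, depending only on $\epsilon$ and $c$, such that the Lebesgue measure of $\mathcal{S}_{\alpha}(N)$ satisfies $$|\mathcal{S}_{\alpha}(N)| \leq C N^{3-4\alpha+\epsilon} \quad \text{for all integers } N \geq 1.$$
   Context: The torus $\mathbb{T}$ is identified with $[0,1]$, and $|\cdot|$ of a set denotes Lebesgue measure. *)

(* Defs.v *)
From mathcomp Require Import all_boot all_order all_algebra.
From mathcomp Require Import all_classical all_reals all_analysis.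
From mathcomp Require Export complex.

Set Implicit Arguments.
Unset Strict Implicit.
Unset Printing Implicit Defensive.

Import Order.TTheory GRing.Theory Num.Theory.

Local Open Scope classical_set_scope.
Local Open Scope ring_scope.

Section WeylSums.
Variable R : realType.

(* e(theta) = exp (2 pi i theta) *)
Definition expc2pi (theta : R) : R[i] :=
  Complex (cos (2 * pi * theta)) (sin (2 * pi * theta)).

Definition weyl_sum (N : nat) (x t : R) : R[i] :=
  \sum_(1 <= n < N.+1) expc2pi (x * n%:R + t * n%:R ^+ 2).

(* The order on [R[i]] makes [`|z|] complex-valued; [normc] is the real modulus. *)
Definition weyl_sup (N : nat) (x : R) : \bar R :=
  ereal_sup [set (ComplexField.Normc.normc (weyl_sum N x t))%:E
            | t in `]0, 1[%classic].

Definition weyl_large_set (c alpha : R) (N : nat) : set R :=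
  [set x | x \in `[0, 1] /\ ((c * N%:R `^ alpha)%:E <= weyl_sup N x)%E].

End WeylSums.

(* Main.v *)
Require Import Defs.
From mathcomp Require Import all_boot all_order all_algebra.
From mathcomp Require Import all_classical all_reals all_analysis.
From mathcomp Require Import ring lra zify.

(** Write S = S(x, t) for the Weyl sum.  Expanding |S|^2 as a double sum over
    (m, n) and grouping by u = m + n, the phase difference
    (m - n) (x + t (m + n)) is, for fixed u, linear in m.  Each inner sum is
    thus a piece of a geometric series, and
      |S|^2 <= sum_(u <= 2N) min(N, 1 / |sin(pi z_u)|),   z_u = 2x + 2tu,
    ([weyl_sum_sqr_le]).  Grouping by m + n rather than by m - n keeps x inside
    the linear phases, so a single bound controls the rational approximations
    of both t and x, and no Gauss sum has to be evaluated.

    Approximate 2t by a/q with q <= 8N (Dirichlet) and 2x by the nearest b/q;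
    put beta = q (2t) - a and theta = q (2x) - b.  Then
      q z_u = (b + ua) + (theta + u beta)   with |theta + u beta| <= 3/4.
    The u for which q does not divide b + ua run evenly through the nonzero
    residue classes and contribute O(N L), where L is a harmonic sum of size
    log N.  The remaining u form one arithmetic progression of step q.  Their
    contribution Z satisfies q Z = O(N^2), counting terms, and
    |theta| Z = O(N L): either theta dominates all the u beta, or theta is
    O(N beta) and the terms are those of a harmonic sum of step beta.
    Hence if |S|^2 >= X with X much larger than N L, then Z >= X / 2 and so
      q = O(N^2 / X)   and   |q (2x) - b| = O(N L / X)
    ([weyl_sum_large_major_arc]).  These conditions no longer mention t.

    For each q at most 2q + 1 numerators b occur, each giving an interval of x
    of length O(N L / (q X)), and there are O(N^2 / X) moduli q: the total
    measure is O(N^3 L / X^2) ([lebesgue_measure_major_arcs]).  Taking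
    X = (c N^alpha / 2)^2 and L = O(N^eps) yields N^(3 - 4 alpha + eps).  When
    X is not much larger than N L, N^(3 - 4 alpha) is bounded below and the
    trivial bound 1 for the measure suffices. *)

Set Implicit Arguments.
Unset Strict Implicit.
Unset Printing Implicit Defensive.

Import Order.TTheory GRing.Theory Num.Theory numFieldNormedType.Exports.

Local Open Scope ring_scope.

(** * Lower bounds for the sine in terms of the distance to the integers *)

Section Trigonometry.
Variable R : realType.
Implicit Types (w z : R).

(** From sin w = 2 sin (w/2) cos (w/2): by the mean value theorem
    sin (w/2) >= (w/2) cos (w/2), and cos^2 (w/2) = (1 + cos w) / 2 >= 1/2. *)
Lemma half_le_sin w : 0 <= w <= pi / 2 -> w / 2 <= sin w.
Proof.
move=> /andP[w0 wpi]; pose v := w / 2.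
have v0 : 0 <= v by rewrite /v; lra.
have [|x] := @MVT_segment R sin cos 0 v v0 (fun x _ => is_derive_sin x).
  by apply/continuous_subspaceT => y; exact: continuous_sin.
rewrite in_itv/= sin0 !subr0 => /andP[x0 xv] Esin.
have pi0 : 0 <= pi :> R := pi_ge0 R.
have cosv : 0 <= cos v by apply: cos_ge0_pihalf; rewrite /v; apply/andP; split; lra.
have cos_xv : cos v <= cos x.
  case: (ltgtP x v) xv => [xv _|//|-> _//].
  apply: ltW; rewrite ltr_cos// in_itv/= /v; apply/andP; split;
    by rewrite /v in xv *; lra.
have w2 : w = v *+ 2 by rewrite /v mulr2n; lra.
have cosw : 0 <= cos w by apply: cos_ge0_pihalf; apply/andP; split; lra.
have cosv2 : 1 / 2 <= cos v * cos v.
  by move: cosw; rewrite w2 cos_mulr2n expr2 mulr2n; lra.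
rewrite w2 sin_mulr2n Esin !mulr2n.
have : cos v * cos v <= cos v * cos x by apply: ler_wpM2l.
have -> : (v + v) / 2 = v by lra.
move=> cc; have : v * (1/2) <= v * (cos v * cos x) by apply: ler_wpM2l => //; lra.
lra.
Qed.

Lemma norm_sinDpi_int z (k : int) : `|sin (z + pi * k%:~R)| = `|sin z|.
Proof.
have natcase (y : R) n : `|sin (y + pi *+ n)| = `|sin y|.
  by rewrite (alternatingn (@sinDpi R)) normrM normrX normrN1 expr1n mul1r.
case: k => n; first by rewrite -pmulrn mulr_natr natcase.
rewrite -[LHS](natcase _ n.+1) NegzE mulrNz mulrN -pmulrn mulr_natr.
by rewrite -addrA addNr addr0.
Qed.

Lemma norm_le_norm_sin w : `|w| <= 1 / 2 -> `|w| <= `|sin (pi * w)|.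
Proof.
move=> hw; have pi2 := pi_ge2 R.
have -> : `|sin (pi * w)| = `|sin (pi * `|w|)|.
  by case: (ger0P w) => // _; rewrite mulrN sinN normrN.
have w0 := normr_ge0 w.
apply: le_trans (ler_norm _); apply: le_trans (half_le_sin _); first nra.
by apply/andP; split; nra.
Qed.

(** The integer k is a nearest one to z.  Together with a bound of a quantity by
    the inverse of |sin (pi z)|, this gives a bound by the inverse of the
    distance from z to the integers. *)
Lemma near_int_sin z :
  exists k : int, `|z - k%:~R| <= 1 / 2 /\ `|z - k%:~R| <= `|sin (pi * z)|.
Proof.
exists (Num.floor (z + 1 / 2)).
set k := Num.floor _.
have /andP[k1 k2] : k%:~R <= z + 1 / 2 < k%:~R + 1.
  by have := floor_itv (z + 1/2); rewrite intrD.
have hk : `|z - k%:~R| <= 1 / 2 by rewrite ler_norml; apply/andP; split; lra.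
split=> //; apply: (le_trans (norm_le_norm_sin hk)).
by rewrite -(norm_sinDpi_int _ k) -mulrDr subrK.
Qed.

End Trigonometry.

(** * The square of a Weyl sum as a sum of linear exponential sums *)

Section WeylSquare.
Variable R : realType.
Implicit Types (x t z : R) (N : nat).

(** Multiplied by 2 sin (pi z), the sum telescopes to a difference of two
    sines. *)
Lemma cos_progression_mul_sin (u z : R) m1 m2 :
  `|\sum_(m1 <= m < m2) cos (pi * ((2 * m%:R - u) * z))| * `|sin (pi * z)| <= 1.
Proof.
have [m12|m21] := leqP m1 m2; last first.
  by rewrite big_geq ?(ltnW m21)// normr0 mul0r.
pose g m : R := sin (pi * ((2 * m%:R - u - 1) * z)).
have E : (\sum_(m1 <= m < m2) cos (pi * ((2 * m%:R - u) * z))) * sin (pi * z) =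
         (g m2 - g m1) / 2.
  rewrite -(telescope_sumr g m12) !mulr_suml; apply: eq_bigr => m _.
  rewrite /g -(natr1 m).
  have -> : pi * ((2 * (m%:R + 1) - u - 1) * z) =
            pi * ((2 * m%:R - u) * z) + pi * z by ring.
  have -> : pi * ((2 * m%:R - u - 1) * z) =
            pi * ((2 * m%:R - u) * z) - pi * z by ring.
  by rewrite sinD sinB; field.
rewrite -normrM E ler_norml /g.
move: (sin_le1 (pi * ((2 * m1%:R - u - 1) * z)))
  (sin_geN1 (pi * ((2 * m1%:R - u - 1) * z)))
  (sin_le1 (pi * ((2 * m2%:R - u - 1) * z)))
  (sin_geN1 (pi * ((2 * m2%:R - u - 1) * z))).
by move=> *; apply/andP; split; lra.
Qed.

(** |sum e(phi n)|^2 is the sum of e(phi m - phi n), of which only the real part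
    survives by symmetry. *)
Lemma normc_sum_expc2pi_sqr (s : seq nat) (phi : nat -> R) :
  Normc.normc (\sum_(n <- s) expc2pi (phi n)) ^+ 2 =
  \sum_(m <- s) \sum_(n <- s) cos (2 * pi * (phi m - phi n)).
Proof.
have -> : \sum_(n <- s) expc2pi (phi n) =
    Complex (\sum_(n <- s) cos (2 * pi * phi n)) (\sum_(n <- s) sin (2 * pi * phi n)).
  by elim: s => [|n s IHs]; rewrite ?big_nil// !big_cons IHs.
rewrite /= sqr_sqrtr ?addr_ge0 ?sqr_ge0// !expr2 !big_distrlr -big_split.
apply: eq_bigr => m _; rewrite -big_split; apply: eq_bigr => n _ /=.
by rewrite mulrBr cosB.
Qed.

Lemma sum_square_antidiagonals (V : zmodType) N (F : nat -> nat -> V) :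
  \sum_(1 <= m < N.+1) \sum_(1 <= n < N.+1) F m n =
  \sum_(0 <= u < (N + N).+1)
    \sum_(maxn 1 (u - N) <= m < minn N.+1 u) F m (u - m)%N.
Proof.
transitivity (\sum_(1 <= m < N.+1) \sum_(0 <= u < (N + N).+1)
    if (m < u <= m + N)%N then F m (u - m)%N else 0).
  apply: eq_big_nat => m /andP[m1 mN]; rewrite -big_mkcond/=.
  transitivity (\sum_(1 + m <= u < (m + N).+1) F m (u - m)%N).
    rewrite big_addn -addnS addKn; apply: eq_big_nat => n _.
    by rewrite addnK.
  rewrite (big_nat_widenl _ 0)// (big_nat_widen _ _ (N + N).+1); last by lia.
  by rewrite /=; apply: eq_bigl => u; rewrite add1n ltnS.
rewrite exchange_big; apply: eq_big_nat => u _; rewrite -big_mkcond/=.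
rewrite [RHS](big_nat_widenl _ 1) ?leq_maxl// [RHS](big_nat_widen _ _ N.+1) ?geq_minl//.
rewrite big_nat_cond [RHS]big_nat_cond; apply: eq_bigl => m; lia.
Qed.

(** T u is the absolute value of the sum over the antidiagonal m + n = u, whose
    phases (2 m - u) (x + t u) are in arithmetic progression. *)
Lemma weyl_sum_sqr_le N x t : exists T : nat -> R,
  [/\ forall u, 0 <= T u <= N%:R,
      forall u, T u * `|sin (pi * (2 * x + 2 * t * u%:R))| <= 1 &
      Normc.normc (weyl_sum N x t) ^+ 2 <= \sum_(0 <= u < (N + N).+1) T u].
Proof.
pose z u : R := 2 * x + 2 * t * u%:R.
exists (fun u => `|\sum_(maxn 1 (u - N) <= m < minn N.+1 u)
                  cos (pi * ((2 * m%:R - u%:R) * z u))|); split.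
- move=> u; rewrite normr_ge0/=; apply: le_trans (ler_norm_sum _ _ _) _.
  apply: (@le_trans _ _ (\sum_(maxn 1 (u - N) <= m < minn N.+1 u) 1)).
    by apply: ler_sum => m _; exact: cos_max.
  by rewrite big_const_nat iter_addr addr0 ler_nat; lia.
- by move=> u; exact: cos_progression_mul_sin.
rewrite /weyl_sum normc_sum_expc2pi_sqr sum_square_antidiagonals.
apply: le_trans (ler_norm _) _; apply: le_trans (ler_norm_sum _ _ _) _.
apply: ler_sum => u _; rewrite le_eqVlt; apply/orP; left; apply/eqP; congr `|_|.
apply: eq_big_nat => m hm; congr cos.
by rewrite natrB ?/z; [ring|lia].
Qed.

End WeylSquare.

(** * Harmonic sums *)

Section HarmonicSums.
Variable R : realType.
Implicit Types (n m K : nat) (kappa B : R).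

(** The n-th harmonic number; the term k = 0 is 0^-1 = 0, which spares index
    shifts when truncated differences of naturals are inverted. *)
Definition harm n : R := \sum_(0 <= k < n.+1) k%:R^-1.

Lemma harm_le m n : (m <= n)%N -> harm m <= harm n.
Proof.
move=> mn; rewrite /harm (@big_cat_nat _ _ _ m.+1 0 n.+1)//= lerDl.
by apply: sumr_ge0 => k _; rewrite invr_ge0.
Qed.

Lemma harm_ge0 n : 0 <= harm n.
Proof. by apply: sumr_ge0 => k _; rewrite invr_ge0. Qed.

Lemma sum_inv_subl m K : (m <= K)%N ->
  \sum_(0 <= j < K) (m - j)%:R^-1 <= harm K :> R.
Proof.
move=> mK; apply: (@le_trans _ _ (\sum_(0 <= j < K.+1) (m - j)%:R^-1)).
  by rewrite [leRHS]big_nat_recr//= lerDl invr_ge0.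
rewrite (@big_cat_nat _ _ _ m.+1 0 K.+1)//= [X in _ + X]big1_seq ?addr0; last first.
  move=> j; rewrite mem_index_iota => /andP[_ /andP[mj _]].
  have -> : (m - j = 0)%N by lia. by rewrite invr0.
rewrite big_nat_rev/=; apply: le_trans (harm_le mK).
rewrite le_eqVlt; apply/orP; left; apply/eqP; apply: eq_big_nat => j jm.
by congr (_%:R^-1); lia.
Qed.

Lemma sum_inv_subr m K : \sum_(0 <= j < K) (j - m)%:R^-1 <= harm K :> R.
Proof.
have [mK|Km] := leqP m K; last first.
  rewrite big1_seq ?harm_ge0// => j; rewrite mem_index_iota => /andP[_ /andP[_ jK]].
  have -> : (j - m = 0)%N by lia. by rewrite invr0.
rewrite (@big_cat_nat _ _ _ m 0 K)//= big1_seq ?add0r; last first.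
  move=> j; rewrite mem_index_iota => /andP[_ /andP[_ jm]].
  have -> : (j - m = 0)%N by lia. by rewrite invr0.
rewrite -{1}[m]add0n big_addn.
under eq_bigr do rewrite addnK.
rewrite /harm [leRHS](@big_cat_nat _ _ _ (K - m) 0 K.+1)//=; last by lia.
by rewrite lerDl sumr_ge0// => j _; rewrite invr_ge0.
Qed.

(** The integer m is the floor of kappa, clamped to the range [0, K], so that all
    distances j - m with j < K are at most K; at j = m and j = m + 1,
    the neighbours of kappa, |j - kappa| has no positive lower bound. *)
Lemma near_floor_dist kappa K : exists2 m, (m <= K)%N & forall j, (j < K)%N ->
  [\/ j = m, j = m.+1,
      (j < m)%N /\ (m - j)%:R <= 2 * `|j%:R - kappa| |
      (m < j)%N /\ (j - m)%:R <= 2 * `|j%:R - kappa|].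
Proof.
have [k0|k0] := leP kappa 0.
  exists 0%N => // -[|j] jK; [exact: Or41|apply: Or44; split=> //].
  rewrite subn0 ger0_norm; last by rewrite subr_ge0 (le_trans k0).
  by have : 0 <= j.+1%:R :> R by []; lra.
have [Kk|kK] := leP K%:R kappa.
  exists K => // j jK; apply: Or43; split=> //.
  rewrite natrB ?(ltnW jK)// ler0_norm; last first.
    by rewrite subr_le0; apply: le_trans Kk; rewrite ler_nat ltnW.
  have : j%:R <= K%:R :> R by rewrite ler_nat ltnW.
  lra.
have /andP[m1 m2] := truncn_itv (ltW k0).
set m := Num.truncn kappa in m1 m2 *.
have mK : (m < K)%N by rewrite -(ltr_nat R); apply: le_lt_trans kK.
exists m; [exact: ltnW|move=> j jK].
rewrite -natr1 in m2.
have [jm|mj|->] := ltngtP j m; last exact: Or41.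
  apply: Or43; split=> //; rewrite natrB ?(ltnW jm)//.
  have : j.+1%:R <= m%:R :> R by rewrite ler_nat.
  rewrite -natr1 => jm'; rewrite ler0_norm; lra.
have [->|j1] := eqVneq j m.+1; first exact: Or42.
apply: Or44; split=> //; rewrite natrB ?(ltnW mj)//.
have : m.+2%:R <= j%:R :> R by rewrite ler_nat; lia.
rewrite -natr1 -natr1 => jm'; rewrite ger0_norm; lra.
Qed.

(** For j away from the at most two values next to kappa, T j is O(B / |j - m|);
    each distance |j - m| occurs at most twice. *)
Lemma sum_le_two_plus_harm K (T : nat -> R) (M kappa B : R) : 0 <= B ->
  (forall j, 0 <= T j <= M) ->
  (forall j, T j * `|j%:R - kappa| <= B) ->
  \sum_(0 <= j < K) T j <= 2 * M + 4 * B * harm K.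
Proof.
move=> B0 TM TB; have [m mK hm] := near_floor_dist kappa K.
have M0 : 0 <= M by have /andP[] := TM 0%N; exact: le_trans.
have far d j : (0 < d)%N -> d%:R <= 2 * `|j%:R - kappa| -> T j <= 2 * B * d%:R^-1.
  move=> d0 hd; rewrite ler_pdivlMr ?ltr0n//.
  have /andP[T0 _] := TM j; have := TB j.
  have := ler_wpM2l T0 hd; lra.
pose S j : R := (j == m)%:R * M + (j == m.+1)%:R * M +
  2 * B * (m - j)%:R^-1 + 2 * B * (j - m)%:R^-1.
apply: (@le_trans _ _ (\sum_(0 <= j < K) S j)).
  apply: ler_sum_nat => j /andP[_ jK].
  have nn d : 0 <= 2 * B * d%:R^-1 :> R by rewrite !mulr_ge0// invr_ge0.
  have nb (b : bool) : 0 <= b%:R * M by rewrite mulr_ge0.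
  have := nn (m - j)%N; have := nn (j - m)%N.
  have := nb (j == m); have := nb (j == m.+1).
  have /andP[_ TMj] := TM j.
  rewrite /S; case: (hm j jK) => [->|->|[jm /far]|[jm /far]].
  - rewrite eqxx mul1r; have := TM m; lra.
  - rewrite eqxx mul1r; have := TM m.+1; lra.
  - by rewrite subn_gt0 => /(_ jm); lra.
  - by rewrite subn_gt0 => /(_ jm); lra.
have one a : \sum_(0 <= j < K) (j == a)%:R * M <= M.
  suff -> : \sum_(0 <= j < K) (j == a)%:R * M = (a < K)%:R * M.
    by case: (a < K)%N; rewrite ?mul1r ?mul0r.
  elim: K {mK hm} => [|k IHk]; first by rewrite big_geq// mul0r.
  rewrite big_nat_recr//= IHk ltnS [in RHS]leq_eqVlt.
  rewrite [(a == k)]eq_sym; case: eqVneq => [->|_]; last by rewrite mul0r addr0.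
  by rewrite ltnn mul0r add0r.
rewrite !big_split/= -!mulr_sumr.
have B2 : 0 <= 2 * B by rewrite mulr_ge0.
have := ler_wpM2l B2 (sum_inv_subl mK); have := ler_wpM2l B2 (sum_inv_subr m K).
have := one m; have := one m.+1; lra.
Qed.

Lemma harm_le_ln n : (0 < n)%N -> harm n <= 1 + ln n%:R.
Proof.
case: n => // n _; elim: n => [|n IHn].
  by rewrite /harm big_nat_recr//= big_nat1 invr0 add0r invr1 ln1 addr0.
rewrite /harm big_nat_recr//= -/(harm n.+1).
set m : R := n.+1%:R in IHn *; have m0 : 0 < m by rewrite ltr0n.
have mE : n.+2%:R = m + 1 :> R by rewrite -natr1.
have m10 : 0 < m + 1 by lra.
have inv1 : (m + 1)^-1 < 1 by rewrite invf_lt1//; lra.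
have inv0 : 0 < (m + 1)^-1 by rewrite invr_gt0.
have mfac : m = (m + 1) * (1 - (m + 1)^-1) by field; rewrite gt_eqF.
have lnm : ln m <= ln (m + 1) - (m + 1)^-1.
  rewrite {1}mfac lnM ?posrE//; last lra.
  by rewrite lerD2l; apply: le_ln1Dx; lra.
rewrite mE; lra.
Qed.

(** harm n <= 1 + ln n, and eta ln y = ln (y^eta) <= y^eta. *)
Lemma harm_le_powR (eta : R) (N : nat) : 0 < eta <= 1 -> (0 < N)%N ->
  harm (10 * N) <= (1 + 10 / eta) * N%:R `^ eta.
Proof.
move=> /andP[e0 e1] N0.
have NR : 1 <= N%:R :> R by rewrite -[1]/(1%:R) ler_nat.
have N10 : 0 < 10 * N%:R :> R by lra.
have h : harm (10 * N) <= 1 + ln (10 * N%:R).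
  by rewrite -natrM; apply: harm_le_ln; rewrite muln_gt0.
have hln : eta * ln (10 * N%:R) <= 10 * N%:R `^ eta.
  rewrite -ln_powR; apply: (@le_trans _ _ ((10 * N%:R) `^ eta)).
    by apply/ltW/ln_sublinear; rewrite powR_gt0.
  rewrite powRM//; apply: ler_wpM2r; first exact: powR_ge0.
  by apply: ler1_powR => //; lra.
have P1 : 1 <= N%:R `^ eta.
  by rewrite -[leLHS](powRr0 N%:R); apply: ler_powR => //; exact: ltW.
apply: (le_trans h).
have : ln (10 * N%:R) <= 10 / eta * N%:R `^ eta.
  by rewrite mulrAC ler_pdivlMr// mulrC.
lra.
Qed.

End HarmonicSums.

(** * Dirichlet approximation with coprime numerator and denominator *)

Section RationalApproximation.
Variable R : realType.

(** Pigeonhole on the fractional parts of 0, tau, ..., M tau in M cells of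
    length 1/M; dividing by the gcd only improves the approximation. *)
Lemma dirichlet_coprime (tau : R) (M : nat) : 0 <= tau -> (0 < M)%N ->
  exists a q : nat, [/\ (0 < q <= M)%N, coprime a q &
    `|q%:R * tau - a%:R| * M%:R <= 1].
Proof.
move=> tau0 M0.
suff [a [q [q0 qM aq]]] : exists a q : nat,
    [/\ (0 < q)%N, (q <= M)%N & `|q%:R * tau - a%:R| * M%:R <= 1].
  have g0 : (0 < gcdn a q)%N by rewrite gcdn_gt0 q0 orbT.
  have qE : q = (q %/ gcdn a q * gcdn a q)%N by rewrite divnK// dvdn_gcdr.
  have aE : a = (a %/ gcdn a q * gcdn a q)%N by rewrite divnK// dvdn_gcdl.
  exists (a %/ gcdn a q)%N, (q %/ gcdn a q)%N; split.
  - rewrite divn_gt0// dvdn_leq ?dvdn_gcdr//=.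
    exact: leq_trans (leq_div _ _) qM.
  - by rewrite /coprime -(eqn_pmul2r g0) muln_gcdl mul1n -aE -qE.
  apply: le_trans aq; apply: ler_wpM2r => //.
  have qR : q%:R = (q %/ gcdn a q)%:R * (gcdn a q)%:R :> R by rewrite -natrM -qE.
  have aR : a%:R = (a %/ gcdn a q)%:R * (gcdn a q)%:R :> R by rewrite -natrM -aE.
  rewrite [in leRHS]qR [in leRHS]aR mulrAC -mulrBl normrM normr_nat ler_peMr//.
  by rewrite -[1]/(1%:R) ler_nat.
pose f (q : nat) : R := q%:R * tau - (Num.truncn (q%:R * tau))%:R.
have f01 q : 0 <= f q < 1.
  have /andP[h1 h2] := truncn_itv (mulr_ge0 (ler0n R q) tau0).
  by rewrite -natr1 in h2; rewrite /f; apply/andP; split; lra.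
have Mp : 0 < M%:R :> R by rewrite ltr0n.
have cell q : (Num.truncn (M%:R * f q) < M)%N.
  have /andP[f0 f1] := f01 q.
  have /andP[h _] := truncn_itv (mulr_ge0 (ltW Mp) f0).
  by rewrite -(ltr_nat R); apply: (le_lt_trans h); rewrite gtr_pMr.
pose g (q : 'I_M.+1) : 'I_M := Ordinal (cell q).
have /injectivePn[q1 [q2 q12 eg]] : ~~ injectiveb g.
  apply/negP => /injectiveP /leq_card; by rewrite !card_ord ltnn.
wlog lt12 : q1 q2 q12 eg / (q1 < q2)%N.
  move=> W; case: (ltngtP q1 q2) => [|lt|/val_inj/eqP]; first exact: W.
    by apply: (W q2 q1); rewrite 1?eq_sym.
  by rewrite (negPf q12).
pose A (q : nat) := Num.truncn (q%:R * tau).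
have leA : (A q1 <= A q2)%N.
  by apply: le_truncn; apply: ler_wpM2r => //; rewrite ler_nat ltnW.
exists (A q2 - A q1)%N, (q2 - q1)%N; split; first by rewrite subn_gt0.
  by have := ltn_ord q2; lia.
have -> : (q2 - q1)%:R * tau - (A q2 - A q1)%:R = f q2 - f q1.
  by rewrite !natrB ?(ltnW lt12)// /f /A; ring.
have {eg} eg : Num.truncn (M%:R * f q1) = Num.truncn (M%:R * f q2).
  by have := congr1 val eg.
have h q : (Num.truncn (M%:R * f q))%:R <= M%:R * f q < (Num.truncn (M%:R * f q)).+1%:R.
  by apply: truncn_itv; rewrite mulr_ge0//; case/andP: (f01 q).
have := h q1; have := h q2; rewrite eg -natr1 => /andP[a1 a2] /andP[b1 b2].
rewrite -(ger0_norm (ltW Mp)) -normrM ler_norml; apply/andP; split; lra.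
Qed.

End RationalApproximation.

(** * Sums over residue classes *)

Section MajorArcs.
Variable R : realType.

(** With r the residue of c, every integer multiple of q is at distance at least
    min (r, q - r) >= 1 from c, hence at least min (r, q - r) / 4 from q z.  The
    minimum is replaced by a sum of inverses, which is easier to sum over r. *)
Lemma le_inv_dist_residue (z T : R) (c q : nat) : 0 <= T ->
  T * `|sin (pi * z)| <= 1 -> `|q%:R * z - c%:R| <= 3 / 4 -> (c %% q != 0)%N ->
  (0 < q)%N ->
  T <= 4 * q%:R * ((c %% q)%:R^-1 + (q - c %% q)%:R^-1).
Proof.
move=> T0 Tsin zc r0 q0.
have rq : (c %% q < q)%N by rewrite ltn_mod.
have cE : c%:R = (c %/ q)%:R * q%:R + (c %% q)%:R :> R.
  by rewrite -natrM -natrD -divn_eq.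
set r := (c %% q)%N in r0 rq cE *.
have [k [_ hk]] := near_int_sin z.
have Tk : T * `|z - k%:~R| <= 1 by apply: le_trans Tsin; exact: ler_wpM2l.
have qR : 1 <= q%:R :> R by rewrite -[1]/(1%:R) ler_nat.
have rR : 1 <= r%:R :> R by rewrite -[1]/(1%:R) ler_nat lt0n.
have qrR : 1 <= q%:R - r%:R :> R.
  by rewrite -natrB ?(ltnW rq)// -[1]/(1%:R) ler_nat subn_gt0.
rewrite natrB ?(ltnW rq)//.
have i1 : 0 <= r%:R^-1 :> R by rewrite invr_ge0.
have i2 : 0 <= (q%:R - r%:R)^-1 :> R by rewrite invr_ge0; lra.
have key (d : R) : 1 <= d -> d - 3 / 4 <= `|q%:R * (z - k%:~R)| ->
    T <= 4 * q%:R * d^-1.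
  move=> d1; rewrite normrM normr_nat => hd.
  rewrite ler_pdivlMr; last lra.
  have : T * d <= T * (4 * (q%:R * `|z - k%:~R|)) by apply: ler_wpM2l => //; lra.
  have : q%:R * (T * `|z - k%:~R|) <= q%:R * 1 :> R by apply: ler_wpM2l.
  lra.
move: zc; rewrite ler_norml => /andP[zc1 zc2].
have [l0|l0] := leP 0 ((c %/ q)%:Z - k).
  have lR : 0 <= (c %/ q)%:R - k%:~R :> R.
    by move: l0; rewrite -(ler0z R) rmorphB.
  have := mulr_ge0 lR (ler0n R q) => lq.
  have : T <= 4 * q%:R * r%:R^-1.
    apply: key => //; apply: le_trans (ler_norm _); lra.
  have : 0 <= 4 * q%:R * (q%:R - r%:R)^-1 :> R by apply: mulr_ge0 => //; apply: mulr_ge0.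
  lra.
have lR : (c %/ q)%:R - k%:~R <= -1 :> R.
  have : ((c %/ q)%:Z - k <= -1)%R by rewrite -ltzD1 addNr.
  by rewrite -(ler_int R) rmorphB rmorphN.
have lq : ((c %/ q)%:R - k%:~R) * q%:R <= - q%:R :> R.
  by rewrite -mulN1r; apply: ler_wpM2r.
have : T <= 4 * q%:R * (q%:R - r%:R)^-1.
  apply: key => //; rewrite -normrN; apply: le_trans (ler_norm _); lra.
have : 0 <= 4 * q%:R * r%:R^-1 :> R by apply: mulr_ge0 => //; apply: mulr_ge0.
lra.
Qed.

(** If k0 is not the integer nearest to z = k0 + w, then z is still at distance
    at least 1/4 >= |w| / 3 from that integer, since |w| <= 3/4. *)
Lemma mul_norm_le3 (z w T : R) (k0 : int) : 0 <= T ->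
  T * `|sin (pi * z)| <= 1 -> z = k0%:~R + w -> `|w| <= 3 / 4 -> T * `|w| <= 3.
Proof.
move=> T0 Tsin zE w34; have [k [_ hk]] := near_int_sin z.
have Tk : T * `|z - k%:~R| <= 1 by apply: le_trans Tsin; exact: ler_wpM2l.
have w0 := normr_ge0 w.
have [kk0|kk0] := eqVneq k k0.
  by move: Tk; rewrite zE kk0 addrAC subrr add0r; lra.
have k1 : 1 <= `|k0%:~R - k%:~R| :> R.
  rewrite -rmorphB -intr_norm -[1]/(1%:~R) ler_int.
  by move: kk0; lia.
have : `|k0%:~R - k%:~R| <= `|z - k%:~R| + `|w| :> R.
  have -> : k0%:~R - k%:~R = z - k%:~R - w :> R by rewrite zE; ring.
  exact: ler_normB.
nra.
Qed.

(** In each of the K blocks of q consecutive u, the map u -> b + u a mod q is a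
    bijection onto the residues, because a is invertible mod q.  The value s
    sent to 0 is the same in all blocks. *)
Lemma sum_split_residue (q K a b : nat) (T g : nat -> R) :
  (0 < q)%N -> coprime a q -> (forall r, 0 <= g r) ->
  (forall u, ((b + u * a) %% q != 0)%N -> T u <= g ((b + u * a) %% q)%N) ->
  exists2 s, (q %| b + s * a)%N &
    \sum_(0 <= u < K * q) T u <=
    \sum_(0 <= j < K) T (j * q + s)%N + K%:R * \sum_(0 <= r < q) g r.
Proof.
move=> q0 cop g0 Tg.
pose rho (s : 'I_q) : 'I_q := Ordinal (ltn_pmod (b + s * a) q0).
have rho_inj : injective rho.
  suff le_inj (s s' : 'I_q) : (s <= s')%N -> rho s = rho s' -> s = s'.
    move=> s s' e; have [ss'|/ltnW s's] := leqP s s'; first exact: le_inj.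
    exact/esym/le_inj.
  move=> ss' /(congr1 val)/= /eqP; rewrite eq_sym eqn_modDl.
  rewrite eqn_mod_dvd ?leq_mul2r ?ss' ?orbT//.
  rewrite -mulnBl Gauss_dvdl 1?coprime_sym// => /dvdn_leq dv; apply: val_inj => /=.
  by have := ltn_ord s'; case: (posnP (s' - s)) => [|/dv]; lia.
pose r0 : 'I_q := Ordinal q0.
have [s hs] : exists s, rho s = r0.
  have [h _ hK] := injF_bij rho_inj. by exists (h r0).
exists (val s).
  by rewrite /dvdn; have /= -> := congr1 val hs.
rewrite big_nat_mul.
have -> : \sum_(0 <= i < K) \sum_(i * q <= j < i.+1 * q) T j =
  \sum_(0 <= i < K) \sum_(l < q) T (i * q + l)%N.
  apply: eq_bigr => i _; rewrite -{1}[(i * q)%N]add0n big_addn mulSn addnK big_mkord.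
  by apply: eq_bigr => l _; rewrite addnC.
rewrite [X in _ + X](_ : _ = \sum_(0 <= i < K) \sum_(l < q) g (rho l)); last first.
  rewrite sumr_const_nat subn0 mulr_natl.
  by rewrite -(reindex_inj rho_inj (P := predT) (F := fun r : 'I_q => g r)) big_mkord.
rewrite -big_split; apply: ler_sum => i _.
rewrite (bigD1 s)//= lerD2l.
rewrite [leRHS](bigD1 s)//=; apply: ler_wpDl => //; apply: ler_sum => l ls.
have e : ((b + (i * q + l) * a) %% q = rho l)%N.
  by rewrite mulnDl addnCA mulnAC modnMDl.
have := Tg (i * q + l)%N; rewrite e; apply; apply: contra_neq ls => h.
by apply: rho_inj; rewrite hs; apply: val_inj.
Qed.

End MajorArcs.

(** * Large values of Weyl sums force rational approximation *)

Section LargeValues.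
Variable R : realType.

(** In the proof, Z collects the u for which q divides b + u a; the other u
    contribute at most 80 N L, half of the assumed lower bound for X, so that
    X <= 2 Z. *)
Lemma weyl_sum_large_major_arc (N : nat) (x t X : R) (L := harm R (10 * N)) :
  (0 < N)%N -> 0 <= x <= 1 -> 0 <= t ->
  160 * N%:R * L <= X -> X <= Normc.normc (weyl_sum N x t) ^+ 2 ->
  exists q b : nat, [/\ (0 < q)%N, (b <= 2 * q)%N,
    q%:R * X <= 20 * N%:R ^+ 2 &
    `|q%:R * (2 * x) - b%:R| * X <= 120 * N%:R * L].
Proof.
move=> N0 /andP[x0 x1] t0 LX XS.
have NR : 1 <= N%:R :> R by rewrite -[1]/(1%:R) ler_nat.
have L1 : 1 <= L.
  apply: (@le_trans _ _ (harm R 1)); last by apply: harm_le; lia.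
  by rewrite /harm big_nat_recr//= big_nat1 invr0 add0r invr1.
have [T [T0N Tsin ST]] := weyl_sum_sqr_le N x t.
have tau0 : 0 <= 2 * t by lra.
have M0 : (0 < 8 * N)%N by rewrite muln_gt0.
have [a [q [/andP[q0 qM] cop hbeta]]] := dirichlet_coprime tau0 M0.
rewrite natrM in hbeta.
set beta := q%:R * (2 * t) - a%:R in hbeta.
have q_gt0 : 0 < q%:R :> R by rewrite ltr0n.
have qn0 : q%:R != 0 :> R by rewrite gt_eqF.
have qR : 1 <= q%:R :> R by rewrite -[1]/(1%:R) ler_nat.
have x20 : 0 <= q%:R * (2 * x) + 1 / 2 by rewrite addr_ge0// !mulr_ge0.
pose b := Num.truncn (q%:R * (2 * x) + 1 / 2).
have /andP[b1 b2] := truncn_itv x20; rewrite -/b in b1 b2; rewrite -(natr1 b) in b2.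
set theta := q%:R * (2 * x) - b%:R.
have htheta : `|theta| <= 1 / 2 by rewrite ler_norml /theta; apply/andP; split; lra.
have bq : (b <= 2 * q)%N.
  rewrite -ltnS -(ltr_nat R) -(natr1 (2 * q)) natrM; apply: (le_lt_trans b1).
  have : q%:R * (2 * x) <= q%:R * 2 by apply: ler_wpM2l => //; lra.
  lra.
(* The blocks of length q overshoot 2N; beyond 2N the bound |u beta| <= 1/4
   is lost, so T' discards these u. *)
pose T' u : R := if (u <= N + N)%N then T u else 0.
have T'0 u : 0 <= T' u <= N%:R.
  by rewrite /T'; case: ifP => // _; rewrite lexx ler0n.
pose W u : R := theta + u%:R * beta.
have ubeta u : (u <= N + N)%N -> `|u%:R * beta| <= 2 * (N%:R * `|beta|).
  move=> uN; rewrite normrM normr_nat mulrA; apply: ler_wpM2r => //.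
  have : u%:R <= (N + N)%:R :> R by rewrite ler_nat.
  by rewrite natrD; lra.
have hW u : (u <= N + N)%N -> `|W u| <= 3 / 4.
  move=> uN; apply: le_trans (ler_normD _ _) _.
  have := ubeta u uN; lra.
have WE u : q%:R * (2 * x + 2 * t * u%:R) - (b + u * a)%:R = W u.
  by rewrite natrD natrM /W /theta /beta; ring.
pose K := ((N + N) %/ q).+1.
have Kq1 : (N + N < K * q)%N by exact: ltn_ceil.
have Kq2 : (K * q <= 10 * N)%N 
  by apply: leq_trans (leq_add qM (leq_trunc_div _ _)) _; rewrite addnn -mul2n -mulnDl.
have KqR : K%:R * q%:R <= 10 * N%:R :> R.
  have : (K * q)%:R <= (10 * N)%:R :> R by rewrite ler_nat.
  by rewrite !natrM.
have K10 : (K <= 10 * N)%N by apply: leq_trans Kq2; rewrite leq_pmulr.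
have q10 : (q <= 10 * N)%N by apply: leq_trans qM _; rewrite leq_mul2r orbT.
pose g r : R := 4 * q%:R * (r%:R^-1 + (q - r)%:R^-1).
have g0 r : 0 <= g r by rewrite /g !mulr_ge0// addr_ge0.
have Tg u : ((b + u * a) %% q != 0)%N -> T' u <= g ((b + u * a) %% q)%N.
  rewrite /T'; case: ifP => // uN r0.
  have /andP[Tu0 _] := T0N u.
  by apply: le_inv_dist_residue (Tsin u) _ _ _; rewrite ?WE ?hW.
have [s qs] := sum_split_residue K q0 cop g0 Tg.
set Z := \sum_(0 <= j < K) _ => splitZ.
have ST' : X <= \sum_(0 <= u < K * q) T' u.
  apply: (le_trans XS); apply: (le_trans ST).
  rewrite [leRHS](@big_cat_nat _ _ _ (N + N).+1)//=.
  apply: ler_wpDr; first by apply: sumr_ge0 => u _; case/andP: (T'0 u).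
  by apply: ler_sum_nat => u /andP[_ uN]; rewrite /T' -ltnS uN.
have sumg : K%:R * (\sum_(0 <= r < q) g r) <= 80 * N%:R * L.
  have hL : harm R q <= L by exact: harm_le.
  have h1 := sum_inv_subr R 0 q; have h2 := sum_inv_subl R (leqnn q).
  have -> : \sum_(0 <= r < q) g r = 4 * q%:R *
     (\sum_(0 <= r < q) (r - 0)%:R^-1 + \sum_(0 <= r < q) (q - r)%:R^-1).
    by rewrite -big_split/= mulr_sumr; apply: eq_bigr => r _; rewrite subn0.
  set S1 := \sum_(0 <= r < q) _ in h1 *; set S2 := \sum_(0 <= r < q) _ in h2 *.
  have -> : K%:R * (4 * q%:R * (S1 + S2)) = 4 * (K%:R * q%:R) * (S1 + S2) by ring.
  apply: (@le_trans _ _ (4 * (K%:R * q%:R) * (2 * L))).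
    by apply: ler_wpM2l; [rewrite !mulr_ge0|lra].
  have := ler_wpM2r (ltW (lt_le_trans ltr01 L1)) KqR; lra.
have XZ : X <= 2 * Z by lra.
have TW j : T' (j * q + s)%N * `|W (j * q + s)%N| <= 3 * q%:R.
  rewrite /T'; case: ifP => uN; last by rewrite mul0r mulr_ge0.
  set u := (j * q + s)%N in uN *.
  have /andP[Tu0 _] := T0N u.
  have /dvdnP[m mE] : (q %| b + u * a)%N.
    by rewrite /u mulnDl addnCA dvdn_add// mulnAC dvdn_mull.
  have zE : 2 * x + 2 * t * u%:R = (m%:Z)%:~R + W u / q%:R.
    by rewrite -WE mE natrM -pmulrn; field.
  have Wq : `|W u / q%:R| = `|W u| / q%:R by rewrite normf_div normr_nat.
  have w34 : `|W u / q%:R| <= 3 / 4.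
    rewrite Wq ler_pdivrMr//; have := hW u uN; lra.
  by have := mul_norm_le3 Tu0 (Tsin u) zE w34; rewrite Wq mulrA ler_pdivrMr.
have ZqN : q%:R * Z <= 10 * N%:R ^+ 2.
  have : Z <= K%:R * N%:R.
    rewrite /Z; apply: (@le_trans _ _ (\sum_(0 <= j < K) N%:R)).
      by apply: ler_sum => j _; case/andP: (T'0 (j * q + s)%N).
    by rewrite sumr_const_nat subn0 mulr_natl.
  move=> /(ler_wpM2l (ler0n R q)); have := ler_wpM2r (ler0n R N) KqR.
  rewrite expr2; lra.
have Ztheta : `|theta| * Z <= 60 * N%:R * L.
  have NL : N%:R <= N%:R * L by rewrite ler_peMr.
  (* Either |theta + u beta| >= |theta| / 2 for all u, or |theta| < 4 N |beta|
     and the terms are spaced by q beta around the zero kappa in j. *)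
  have [far|near] := leP (4 * (N%:R * `|beta|)) `|theta|.
    have : `|theta| * Z <= K%:R * (6 * q%:R).
      rewrite mulr_sumr; apply: (@le_trans _ _ (\sum_(0 <= j < K) 6 * q%:R)).
        apply: ler_sum => j _; have := TW j; set u := (j * q + s)%N => TWu.
        have [uN|uN] := leqP u (N + N)%N; last first.
          by rewrite /T' leqNgt uN/= mulr0 mulr_ge0.
        have : `|theta| <= 2 * `|W u|.
          have := ubeta u uN; have := lerB_normD theta (u%:R * beta).
          rewrite -/(W u); lra.
        have /andP[Tu0 _] := T'0 u.
        move/(ler_wpM2l Tu0); lra.
      by rewrite sumr_const_nat subn0 [K%:R * _]mulr_natl.
    lra.
  have beta0 : 0 < `|beta|.
    rewrite lt_neqAle normr_ge0 andbT; apply/eqP => b0.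
    by move: near; rewrite -b0 !mulr0 ltNge normr_ge0.
  have bn0 : beta != 0 by rewrite -normr_gt0.
  pose kappa := - (theta + s%:R * beta) / (q%:R * beta).
  have Tk j : T' (j * q + s)%N * `|j%:R - kappa| <= 3 / `|beta|.
    have WjE : W (j * q + s)%N = (j%:R - kappa) * (q%:R * beta).
      rewrite /W /kappa natrD natrM; by field; rewrite ?bn0 ?qn0.
    have := TW j; rewrite WjE !normrM normr_nat => TWj.
    rewrite ler_pdivlMr// -(ler_pM2r q_gt0); lra.
  have B0 : 0 <= 3 / `|beta| by rewrite divr_ge0.
  have := sum_le_two_plus_harm K B0 (fun j => T'0 (j * q + s)%N) Tk.
  rewrite -/Z => ZH.
  have hL : harm R K <= L by exact: harm_le.
  have ZL : Z <= 2 * N%:R + 12 * L / `|beta|.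
    have := ler_wpM2l B0 hL; lra.
  have : `|theta| * Z <= `|theta| * (2 * N%:R) + `|theta| * (12 * L / `|beta|).
    by rewrite -mulrDr; apply: ler_wpM2l.
  have : `|theta| * (2 * N%:R) <= 1 / 2 * (2 * N%:R) by apply: ler_wpM2r => //; lra.
  have : `|theta| * (12 * L / `|beta|) <= 4 * (N%:R * `|beta|) * (12 * L / `|beta|).
    apply: ler_wpM2r; last exact: ltW.
    by rewrite divr_ge0//; lra.
  have -> : 4 * (N%:R * `|beta|) * (12 * L / `|beta|) = 48 * (N%:R * L).
    by field; rewrite gt_eqF.
  lra.
exists q, b; split => //.
  have := ler_wpM2l (ler0n R q) XZ; lra.
rewrite -/theta; have := ler_wpM2l (normr_ge0 theta) XZ; lra.
Qed.

End LargeValues.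

(** * The measure of the major arcs *)

Section Measure.
Variable R : realType.

(** Monotonicity holds for arbitrary sets because the Lebesgue measure is defined
    as an outer measure; it dispenses with proving that the large set is
    measurable. *)
Lemma le_lebesgue_measure (A B : set R) : (A `<=` B)%classic ->
  ((@lebesgue_measure R) A <= (@lebesgue_measure R) B)%E.
Proof.
move=> AB; rewrite /lebesgue_measure /lebesgue_stieltjes_measure.
by rewrite /measure_extension /=; exact: le_mu_ext.
Qed.

Lemma lebesgue_measure_centered_itv (c r : R) : 0 <= r ->
  (@lebesgue_measure R) [set` `[c - r, c + r]] = (2 * r)%:E.
Proof.
move=> r0; rewrite lebesgue_measure_itv/= lte_fin.
have [h|h] := ltP (c - r) (c + r); first by rewrite -EFinD; congr _%:E; ring.
by congr _%:E; lra.
Qed.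

Lemma lebesgue_measure_cover (I : choiceType) (s : seq I) (c r : I -> R) (A : set R) :
  (forall i, 0 <= r i) ->
  (forall x, A x -> exists2 i, i \in s & `|x - c i| <= r i) ->
  ((@lebesgue_measure R) A <= (\sum_(i <- s) 2 * r i)%:E)%E.
Proof.
move=> r0 cover; pose J i : set R := `[c i - r i, c i + r i]%classic.
have mJ i : measurable (J i) by exact: measurable_itv.
apply: (@le_trans _ _ ((@lebesgue_measure R) (\big[setU/set0]_(i <- s) J i))).
  apply: le_lebesgue_measure => x /cover[i si]; rewrite ler_norml => /andP[h1 h2].
  rewrite -bigcup_seq; exists i => //=.
  by rewrite /J/= in_itv/=; apply/andP; split; lra.
elim: s {cover} => [|i s IHs]; first by rewrite !big_nil measure0.
rewrite !big_cons EFinD -(lebesgue_measure_centered_itv (c i) (r0 i)).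
have mU : measurable (\big[setU/set0]_(i <- s) J i) by exact: bigsetU_measurable.
apply: le_trans (@measureU2 _ _ _ (@lebesgue_measure R) _ _ (mJ i) mU) _.
by rewrite leeD2l.
Qed.

(** The arcs are the intervals centred at b / (2q) of length D / (q X), for
    1 <= q <= Y / X and 0 <= b <= 2q: each q contributes at most
    (2q + 1) D / (q X) <= 3 D / X. *)
Lemma lebesgue_measure_major_arcs (A : set R) (X Y D : R) :
  0 < X -> 0 <= Y -> 0 <= D ->
  (forall x, A x -> exists q b : nat, [/\ (0 < q)%N, (b <= 2 * q)%N,
    q%:R * X <= Y & `|q%:R * (2 * x) - b%:R| * X <= D]) ->
  ((@lebesgue_measure R) A <= (3 * D * Y / X ^+ 2)%:E)%E.
Proof.
move=> X0 Y0 D0 cover.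
have YX : 0 <= Y / X by rewrite divr_ge0// ltW.
pose Q := Num.truncn (Y / X); have /andP[Q1 Q2] := truncn_itv YX.
rewrite -/Q in Q1 Q2.
pose s := [seq (q, b) | q <- iota 1 Q, b <- iota 0 (2 * q).+1].
pose c (i : nat * nat) : R := i.2%:R / (2 * i.1%:R).
pose r (i : nat * nat) : R := D / (2 * i.1%:R * X).
have r0 i : 0 <= r i by rewrite /r divr_ge0// !mulr_ge0// ltW.
apply: le_trans (@lebesgue_measure_cover _ s c r A r0 _) _.
  move=> x /cover[q [b [q0 bq qX qb]]]; exists (q, b).
    apply/allpairsPdep; exists q, b; split=> //; rewrite mem_iota.
      rewrite q0 add1n ltnS -ltnS -(ltr_nat R); apply: le_lt_trans Q2.
      by rewrite ler_pdivlMr.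
    by rewrite add0n ltnS.
  have q_gt0 : 0 < q%:R :> R by rewrite ltr0n.
  have q2 : 0 < 2 * q%:R :> R by lra.
  rewrite /r /c/= ler_pdivlMr; last exact: mulr_gt0.
  have -> : x - b%:R / (2 * q%:R) = (q%:R * (2 * x) - b%:R) / (2 * q%:R).
    by field; rewrite gt_eqF.
  by rewrite normf_div (gtr0_norm q2) [leLHS]mulrA mulfVK ?gt_eqF.
rewrite lee_fin /s big_allpairs_dep.
apply: (@le_trans _ _ (\sum_(q <- iota 1 Q) 3 * D / X)).
  rewrite big_seq [leRHS]big_seq; apply: ler_sum => q; rewrite mem_iota => /andP[q0 _].
  have qR : 1 <= q%:R :> R by rewrite -[1]/(1%:R) ler_nat.
  rewrite (eq_bigr (fun=> 2 * (D / (2 * q%:R * X))))//.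
  rewrite big_const_seq count_predT size_iota iter_addr addr0 -[leLHS]mulr_natr.
  rewrite -(natr1 (2 * q)) natrM.
  have -> : 2 * (D / (2 * q%:R * X)) * (2 * q%:R + 1) =
     (2 * q%:R + 1) / q%:R * (D / X).
    by field; rewrite !gt_eqF//; lra.
  rewrite -[leRHS]mulrA; apply: ler_wpM2r; first by rewrite divr_ge0// ltW.
  rewrite ler_pdivrMr; lra.
rewrite big_const_seq count_predT size_iota iter_addr addr0 -[leLHS]mulr_natr.
have -> : 3 * D * Y / X ^+ 2 = 3 * D / X * (Y / X) by field; rewrite gt_eqF.
by apply: ler_wpM2l => //; rewrite divr_ge0 ?mulr_ge0// ltW.
Qed.

End Measure.

(** * The large set *)

Section LargeSet.
Variable R : realType.

(** The supremum need not be attained, whence the factor 1/2. *)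
Lemma weyl_large_set_witness (c alpha : R) (N : nat) (x : R) :
  0 < c -> (0 < N)%N -> weyl_large_set c alpha N x ->
  0 <= x <= 1 /\ exists2 t, 0 <= t &
    (c * N%:R `^ alpha / 2) ^+ 2 <= Normc.normc (weyl_sum N x t) ^+ 2.
Proof.
move=> c0 N0 [x01 xsup]; split; first by move: x01; rewrite in_itv.
have P0 : 0 < c * N%:R `^ alpha by rewrite mulr_gt0// powR_gt0// ltr0n.
have /ereal_sup_gt[_ [t t01 <-]] : ((c * N%:R `^ alpha / 2)%:E < weyl_sup N x)%E.
  by apply: lt_le_trans xsup; rewrite lte_fin; lra.
rewrite lte_fin => ht; exists t.
  by move: t01; rewrite /= in_itv/= => /andP[/ltW].
by rewrite ler_sqr ?nnegrE; [exact: ltW|lra|apply: le_trans (ltW ht); lra].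
Qed.

Lemma lebesgue_measure_weyl_large_set_le1 (c alpha : R) (N : nat) :
  ((@lebesgue_measure R) (weyl_large_set c alpha N) <= 1)%E.
Proof.
apply: (@le_trans _ _ ((@lebesgue_measure R) `[0, 1]%classic)).
  by apply: le_lebesgue_measure => x [].
by rewrite lebesgue_measure_itv/= lte_fin ltr01 sube0.
Qed.

End LargeSet.

Theorem corollary3p1 (R : realType) (c : R) (hc : 0 < c)
    (eps : R) (heps : 0 < eps) :
  exists C : R, 0 < C /\
    forall alpha : R, 3 / 4 < alpha -> alpha <= 1 ->
    forall N : nat, (1 <= N)%N ->
      ((@lebesgue_measure R) (@weyl_large_set R c alpha N) <=
       (C * N%:R `^ (3 - 4 * alpha + eps))%:E)%E.
Proof.
(* The bound eta <= 1/2 makes L^2 = O(N), which the trivial case needs. *)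
pose eta : R := Num.min eps (1 / 2).
have eta0 : 0 < eta by rewrite lt_min heps/=; lra.
have eta_eps : eta <= eps by rewrite ge_min lexx.
have eta2 : eta <= 1 / 2 by rewrite ge_min lexx orbT.
pose D := 1 + 10 / eta; have D0 : 0 < D by rewrite addr_gt0// divr_gt0.
(* The constants are abstracted so that numerals of this size are never
   unfolded as unary naturals. *)
have [k1 k1_gt0 k1E] : exists2 k : R, 0 < k & k = 48 * 120 * 20.
  by eexists; [|reflexivity]; lra.
have [k2 k2_gt0 k2E] : exists2 k : R, 0 < k & k = 160 ^+ 2.
  by eexists; [|reflexivity]; exact: exprn_gt0.
exists ((k1 * D + 16 * k2 * D ^+ 2) / c ^+ 4); split.
  by rewrite divr_gt0 ?exprn_gt0// addr_gt0 ?mulr_gt0// exprn_gt0.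
move=> alpha _ _ N N0.
have NR : 1 <= N%:R :> R by rewrite -[1]/(1%:R) ler_nat.
have N_gt0 : 0 < N%:R :> R by lra.
pose L := harm R (10 * N); pose P := N%:R `^ alpha; pose E := N%:R `^ eps.
have P0 : 0 < P by exact: powR_gt0.
have powE : N%:R `^ (3 - 4 * alpha + eps) = N%:R ^+ 3 * E / P ^+ 4.
  have N0' : N%:R != 0 :> R by rewrite gt_eqF.
  rewrite powRD ?N0' ?implybT// powRB ?N0' ?implybT// powR_mulrn ?ler0n//.
  by rewrite [4 * alpha]mulrC powRrM powR_mulrn ?powR_ge0// mulrAC.
have LD : L <= D * N%:R `^ eta by apply: harm_le_powR => //; apply/andP; split; lra.
have NE : N%:R `^ eta <= E by exact: ler_powR.
have E1 : 1 <= E.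
  by rewrite -[leLHS](powRr0 N%:R); apply: ler_powR => //; exact: ltW.
have L0 : 0 <= L by exact: harm_ge0.
have Neta2 : (N%:R `^ eta) ^+ 2 <= N%:R.
  rewrite -powR_mulrn ?powR_ge0// -powRrM -[leRHS]powRr1 ?ler0n//.
  by apply: ler_powR => //; lra.
pose X := (c * P / 2) ^+ 2.
have X0 : 0 < X by rewrite exprn_gt0// divr_gt0// mulr_gt0.
have XE : X ^+ 2 = c ^+ 4 * P ^+ 4 / 16 by rewrite /X; field.
have cP : 0 < c ^+ 4 * P ^+ 4 by rewrite mulr_gt0// exprn_gt0.
have -> : (k1 * D + 16 * k2 * D ^+ 2) / c ^+ 4 * N%:R `^ (3 - 4 * alpha + eps) =
   (k1 * D + 16 * k2 * D ^+ 2) * (N%:R ^+ 3 * E) / (c ^+ 4 * P ^+ 4).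
  by rewrite powE; field; rewrite !gt_eqF.
have N3 : 0 <= N%:R ^+ 3 :> R by exact: exprn_ge0.
have D2 : 0 <= D ^+ 2 by exact: sqr_ge0.
(* If X < 160 N L then X^2 = O(N^2 L^2) = O(N^3), so N^3 / P^4 is bounded
   below and the trivial bound 1 is enough. *)
have [LX|XL] := leP (160 * N%:R * L) X; last first.
  apply: (le_trans (lebesgue_measure_weyl_large_set_le1 _ _ _)).
  rewrite lee_fin ler_pdivlMr// mul1r.
  have : X ^+ 2 <= (160 * N%:R * (D * N%:R `^ eta)) ^+ 2.
    rewrite ler_sqr ?nnegrE; [|exact: ltW|by rewrite !mulr_ge0 ?powR_ge0// ltW].
    by apply: (le_trans (ltW XL)); apply: ler_wpM2l => //; rewrite mulr_ge0.
  have -> : (160 * N%:R * (D * N%:R `^ eta)) ^+ 2 =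
     k2 * D ^+ 2 * N%:R ^+ 2 * (N%:R `^ eta) ^+ 2 by rewrite k2E; ring.
  have : k2 * D ^+ 2 * N%:R ^+ 2 * (N%:R `^ eta) ^+ 2 <=
     k2 * D ^+ 2 * N%:R ^+ 2 * N%:R.
    by apply: ler_wpM2l => //; rewrite !mulr_ge0 ?sqr_ge0 ?ltW.
  have -> : k2 * D ^+ 2 * N%:R ^+ 2 * N%:R = k2 * (D ^+ 2 * N%:R ^+ 3) by ring.
  have : 0 <= k1 * D * (N%:R ^+ 3 * E).
    by rewrite !mulr_ge0 ?powR_ge0// ltW.
  have : k2 * (D ^+ 2 * N%:R ^+ 3) * 1 <= k2 * (D ^+ 2 * N%:R ^+ 3) * E.
    by apply: ler_wpM2l => //; rewrite !mulr_ge0// ltW.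
  rewrite XE; lra.
have D120 : 0 <= 120 * N%:R * L by rewrite !mulr_ge0.
have Y20 : 0 <= 20 * N%:R ^+ 2 :> R by rewrite mulr_ge0// sqr_ge0.
apply: le_trans (lebesgue_measure_major_arcs X0 Y20 D120 _) _.
  move=> x /(weyl_large_set_witness hc N0)[x01 [t t0 XS]].
  exact: weyl_sum_large_major_arc t0 LX XS.
rewrite lee_fin XE.
have -> : 3 * (120 * N%:R * L) * (20 * N%:R ^+ 2) / (c ^+ 4 * P ^+ 4 / 16) =
   k1 * (N%:R ^+ 3 * L) / (c ^+ 4 * P ^+ 4).
  by rewrite k1E; field; rewrite !gt_eqF.
apply: ler_wpM2r; first by rewrite invr_ge0 ltW.
have LE : L <= D * E by apply: (le_trans LD); apply: ler_wpM2l => //; exact: ltW.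
have k2D : 0 <= k2 * (D ^+ 2 * (N%:R ^+ 3 * E)).
  by rewrite mulr_ge0 ?(ltW k2_gt0)// mulr_ge0// mulr_ge0 ?powR_ge0.
have := ler_wpM2l (ltW k1_gt0) (ler_wpM2l N3 LE); lra.
Qed.
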